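(* Let $\psi$ satisfy the interior condition stated in the context. Assume that, almost surely, $f_\xi$ is $L$-smooth relative to $\psi$ on $\mathcal X$ (with $L>0$); neither $f$ nor $f_\xi$ is assumed convex. Let $(x_t)_{t\ge1}$ be the iterates of stochastic mirror descent with constant stepsize $0<\eta\le\frac1L$. Then for every $x_\ast\in\mathcal X_\ast$ and every $t\ge1$, $$\mathbb E\left[\frac1t\sum_{s=1}^tB_f(x_\ast;x_s)\right]\le\frac{B_\psi(x_\ast;x_1)}{\eta t}+\sigma_{\mathcal X}^2.$$
   Context: Setting. $\mathcal X\subseteq\mathbb R^d$ is a nonempty closed convex set (possibly unbounded), $\psi:\mathcal D\to\mathbb R$ is a convex function, differentiable on $\operatorname{int}\mathcal D$, with $\mathcal X\subseteq\mathcal D\subseteq\mathbb R^d$. $\xi$ is a random vector supported on a set $\Xi$. The functions $f_\xi$ and $f(x)=\mathbb E_\xi[f_\xi(x)]$ are real-valued on $\mathcal X$ and differentiable at the points of $\mathcal X\cap\operatorname{int}\mathcal D$ (being defined in a neighbourhood of each such point), with $\mathbb E_\xi[\nabla f_\xi(x)]=\nabla f(x)$ there; all expectations involved are assumed well defined. $\mathcal X_\ast$ is the set of minimizers of $f$ over $\mathcal X$, assumed nonempty. Bregman divergence: for a function $h$ differentiable at $y$, $B_h(x;y)=h(x)-h(y)-\langle\nabla h(y),x-y\rangle$. Relative smoothness: $h$ is $L$-smooth relative to $\psi$ on $\mathcal X$ if $B_h(x;y)\le L B_\psi(x;y)$ for all $(x,y)\in\mathcal X\times(\mathcal X\cap\operatorname{int}\mathcal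 D)$. Interior condition on $\psi$: for every $x_t\in\mathcal X\cap\operatorname{int}\mathcal D$, every vector $g$ and every stepsize $\eta_t>0$, the point $x_{t+1}=\arg\min_{x\in\mathcal X}\{\langle g,x\rangle+\frac1{\eta_t}B_\psi(x;x_t)\}$ exists and lies in $\operatorname{int}\mathcal D$. Stochastic mirror descent with constant stepsize $\eta$: $x_1\in\mathcal X\cap\operatorname{int}\mathcal D$ is deterministic, $\xi_1,\xi_2,\dots$ are i.i.d. copies of $\xi$, and $x_{t+1}=\arg\min_{x\in\mathcal X}\{\langle\nabla f_{\xi_t}(x_t),x\rangle+\frac1\eta B_\psi(x;x_t)\}$ for $t\ge1$. Constrained finite optimal objective difference: $\sigma_{\mathcal X}^2=f(x_\ast)-\mathbb E_\xi[f_\xi^\ast(\mathcal X)]$ where $x_\ast\in\mathcal X_\ast$ and $f_\xi^\ast(\mathcal X)=\inf_{x\in\mathcal X}f_\xi(x)$; it is assumed that $\sigma_{\mathcal X}^2<\infty$. *)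

(* Defs.v *)
From HB Require Import structures.
From mathcomp Require Import all_boot all_order all_algebra.
From mathcomp Require Import all_classical all_reals all_analysis.
From mathcomp Require Import measurable_realfun.

Set Implicit Arguments.
Unset Strict Implicit.
Unset Printing Implicit Defensive.

Import Order.TTheory GRing.Theory Num.Theory.
Import numFieldNormedType.Exports.

Local Open Scope classical_set_scope.
Local Open Scope ring_scope.

Section deterministic.
Context (R : realType) (d : nat).
Implicit Types (h psi : 'rV[R]_d -> R) (X D : set 'rV[R]_d) (u v x y g : 'rV[R]_d).

Definition inner u v : R := \sum_(i < d) u ord0 i * v ord0 i.

Definition gradient h y : 'rV[R]_d :=
  \row_(i < d) 'D_(delta_mx ord0 i) h y.

Definition bregman h x y : R := h x - h y - inner (gradient h y) (x - y).

Definition argmin X h : set 'rV[R]_d :=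
  [set x | X x /\ forall z, X z -> h x <= h z].

(* Functions given on a subset of R^d only (psi on D, the objectives on X and
   near X `&` D°) are total here; their values elsewhere are irrelevant. *)
Definition rel_smooth psi X D (L : R) h : Prop :=
  forall x y, X x -> X y -> D° y -> bregman h x y <= L * bregman psi x y.

Definition mirror_step psi X (eta : R) g y : set 'rV[R]_d :=
  argmin X (fun x => inner g x + eta^-1 * bregman psi x y).

(* psi is not assumed strictly convex, so minimizers form a set: it is
   nonempty and all of them are interior.  When the minimizer is unique this
   says that "the" minimizer exists and is interior. *)
Definition interior_condition psi X D : Prop :=
  forall y g (eta : R), X y -> D° y -> 0 < eta ->
    mirror_step psi X eta g y !=set0 /\ mirror_step psi X eta g y `<=` D°.

End deterministic.

Section expectation.
Context (R : realType) (dO : measure_display) (Omega : measurableType dO).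
Implicit Type P : probability Omega R.

(* 'E_P[Y] is meaningful in [-oo, +oo]: not of the form +oo - +oo. *)
Definition has_expectation P (Y : Omega -> R) : Prop :=
  measurable_fun setT Y /\
  ((\int[P]_w (EFin \o Y)^\+ w < +oo)%E \/ (\int[P]_w (EFin \o Y)^\- w < +oo)%E).

End expectation.

(* mu is the law of the random vector xi, with values in the measurable space
   Xi; F z is the objective at the sample z, and expectations over xi are
   integrals with respect to mu. *)
Section objective.
Context (R : realType) (d : nat) (dXi : measure_display)
  (Xi : measurableType dXi) (mu : probability Xi R) (F : Xi -> 'rV[R]_d -> R).
Implicit Types (X D : set 'rV[R]_d).

Definition mean_objective (x : 'rV[R]_d) : R := fine 'E_mu[F ^~ x].

Definition sample_inf X (z : Xi) : \bar R := ereal_inf [set (F z x)%:E | x in X].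

Definition sigma2 X (xstar : 'rV[R]_d) : \bar R :=
  ((mean_objective xstar)%:E - \int[mu]_z sample_inf X z)%E.

Record stochastic_objective X D : Prop := {
  so_integrable : forall x, X x ->
    mu.-integrable setT (EFin \o F ^~ x) ;
  so_integrable_near : forall x, X x -> D° x ->
    \forall y \near x, mu.-integrable setT (EFin \o F ^~ y) ;
  so_differentiable : forall z x, X x -> D° x -> differentiable (F z) x ;
  so_mean_differentiable : forall x, X x -> D° x ->
    differentiable mean_objective x ;
  so_gradient_integrable : forall x i, X x -> D° x ->
    mu.-integrable setT (fun z => (gradient (F z) x ord0 i)%:E) ;
  so_gradient_mean : forall x i, X x -> D° x ->
    'E_mu[fun z => gradient (F z) x ord0 i]%E
      = (gradient mean_objective x ord0 i)%:E ;
  so_inf_measurable : measurable_fun setT (sample_inf X)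
}.

End objective.

(* The sample sequence xi and the iterates x are indexed from 1; index 0 is
   unused. *)
Section process.
Context (R : realType) (d : nat) (dXi dO : measure_display)
  (Xi : measurableType dXi) (Omega : measurableType dO)
  (P : probability Omega R).
Implicit Type xi : nat -> {RV P >-> Xi}.

Definition mutually_independent xi : Prop :=
  forall (J : seq nat) (A : nat -> set Xi),
    uniq J -> {in J, forall j, (0 < j)%N} -> (forall j, measurable (A j)) ->
    P (\bigcap_(j in [set` J]) (xi j @^-1` A j))
      = (\prod_(j <- J) P (xi j @^-1` A j))%E.

Definition iid_copies (mu : probability Xi R) xi : Prop :=
  (forall t (A : set Xi), (0 < t)%N -> measurable A ->
     distribution P (xi t) A = mu A) /\
  mutually_independent xi.

(* The sigma-algebra generated by xi_1, ..., xi_(t-1). *)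
Definition past xi (t : nat) : set (set Omega) :=
  <<s \bigcup_(s in [set s | (0 < s < t)%N])
        preimage_set_system setT (xi s) measurable >>.

(* smd_adapted: the iterate x_t is a Borel random vector determined by the
   samples drawn so far.  It is stated because minimizers may be non-unique and
   because a pointwise selection of minimizers need not be measurable. *)
Record smd_iterates (psi : 'rV[R]_d -> R) (X : set 'rV[R]_d)
    (F : Xi -> 'rV[R]_d -> R) (eta : R) xi (x1 : 'rV[R]_d)
    (x : nat -> Omega -> 'rV[R]_d) : Prop := {
  smd_init : forall w, x 1%N w = x1 ;
  smd_step : forall t w, (0 < t)%N ->
    mirror_step psi X eta (gradient (F (xi t w)) (x t w)) (x t w) (x t.+1 w) ;
  smd_adapted : forall t (B : set 'rV[R]_d), (0 < t)%N ->
    <<s @open 'rV[R]_d >> B -> past xi t (x t @^-1` B)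
}.

End process.

(* Main.v *)
Require Import Defs.
From HB Require Import structures.
From mathcomp Require Import all_boot all_order all_algebra.
From mathcomp Require Import all_classical all_reals all_analysis.
From mathcomp Require Import measurable_realfun.
From mathcomp Require Import ring lra.

Set Implicit Arguments.
Unset Strict Implicit.
Unset Printing Implicit Defensive.

Import Order.TTheory GRing.Theory Num.Theory.
Import numFieldNormedType.Exports.

Local Open Scope classical_set_scope.
Local Open Scope ring_scope.

(* Write z for the sample xi_t and x' for a minimizer of f over X.  Optimality
   of the mirror step, the three-point identity and relative smoothness with
   eta <= 1/L give, for almost every z,
     B_{F_z}(x'; x_t) + B_psi(x'; x_{t+1}) / eta
       <= F_z(x') - inf_X F_z + B_psi(x'; x_t) / eta.
   Since x_t depends only on the past and z is independent of it, averaging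
   over z turns the first term into B_f(x'; x_t) and the gap into sigma^2, so
     M_t = B_psi(x'; x_t) / eta + sum_{s < t} B_f(x'; x_s) - (t - 1) sigma^2
   should be a supermartingale started at B_psi(x'; x_1) / eta.  Nothing
   guarantees that M_t is integrable: the inequality only holds after
   localizing to events of the past on which M_t, B_psi(x'; x_t) and
   E|B_{F_z}(x'; x_t)| are bounded.  If the negative part of the average in the
   theorem is not integrable then its expectation is -oo.  Otherwise the
   negative part of M_{t+1} is integrable; this propagates backwards in time to
   all M_s, and then integrability and E M_{s+1} <= E M_s propagate forwards
   from M_1. *)

(** * The deterministic one-step inequality *)

Section deterministic_step.
Context (R : realType) (d : nat).
Implicit Types (h psi : 'rV[R]_d -> R) (X D : set 'rV[R]_d).
Implicit Types (u v x y g : 'rV[R]_d).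

Lemma innerDr g u v : inner g (u + v) = inner g u + inner g v.
Proof.
by rewrite /inner -big_split; apply: eq_bigr => i _; rewrite mxE mulrDr.
Qed.

Lemma innerZr g a u : inner g (a *: u) = a * inner g u.
Proof.
by rewrite /inner mulr_sumr; apply: eq_bigr => i _; rewrite mxE mulrCA.
Qed.

Lemma innerBr g u v : inner g (u - v) = inner g u - inner g v.
Proof. by rewrite innerDr -scaleN1r innerZr mulN1r. Qed.

Lemma diff_gradient h y v : differentiable h y ->
  'd h y v = inner (gradient h y) v.
Proof.
move=> dh; rewrite {1}(row_sum_delta v) linear_sum /inner.
apply: eq_bigr => i _.
by rewrite linearZ/= mxE deriveE// mulrC.
Qed.

Lemma gradient_expansion h y (e : R) : differentiable h y -> 0 < e ->
  \forall v \near (0 : 'rV[R]_d),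
    `|h (v + y) - h y - inner (gradient h y) v| <= e * `|v|.
Proof.
move=> dh e0.
have /eqaddoP/(_ _ e0) := diff_locally dh.
apply: filterS => v /=.
by rewrite !fctE /= opprD addrA diff_gradient.
Qed.

(** A bound on difference quotients survives the limit as [s] tends to 0. The factor [sg] fixes the
    sign and scale: -1 serves the tangent inequality of a convex function, [eta^-1] the optimality
    of a mirror step. *)
Lemma gradient_ge h y v (sg c : R) : differentiable h y ->
  (forall s, 0 < s < 1 -> s * c <= sg * (h (s *: v + y) - h y)) ->
  c <= sg * inner (gradient h y) v.
Proof.
move=> dh H; apply/ler_addgt0Pr => e e0.
(* With this tolerance the first-order error, divided by [s] and scaled by [sg], is at most [e]; the
   added 1 keeps the denominator positive. *)
pose k := e / (1 + `|sg| * `|v|).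
have k1 : 0 < 1 + `|sg| * `|v| by rewrite ltr_pwDl// mulr_ge0.
have k0 : 0 < k by rewrite divr_gt0.
have /nbhs_ballP[r /= r0 Hr] := gradient_expansion dh k0.
(* The first bound gives [s < 1], the second puts [s *: v] inside the ball of radius [r]. *)
pose s := Num.min (2^-1) (r / (1 + `|v|) / 2).
have s0 : 0 < s by rewrite lt_min invr_gt0 ltr0n/= !divr_gt0// ltr_pwDl.
have s1 : s < 1 by rewrite gt_min invf_lt1// ltr1n.
have /H : 0 < s < 1 by rewrite s0.
have sv : `|s *: v| = s * `|v| by rewrite normrZ gtr0_norm.
have : ball (0 : 'rV[R]_d) r (s *: v).
  rewrite -ball_normE /= sub0r normrN sv.
  have : s <= r / (1 + `|v|) / 2 by rewrite ge_min lexx orbT.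
  rewrite -(ler_pM2r (x := 1 + `|v|)) ?ltr_pwDl//.
  rewrite mulrAC divfK ?gt_eqF ?ltr_pwDl// => Hs.
  have := normr_ge0 v; nra.
move=> /Hr /=; rewrite sv innerZr => Hd Hs.
rewrite -(ler_pM2l s0); apply: (le_trans Hs).
rewrite (mulrDr s) -lerBlDl.
have -> : sg * (h (s *: v + y) - h y) - s * (sg * inner (gradient h y) v) =
  sg * (h (s *: v + y) - h y - s * inner (gradient h y) v) by ring.
apply: (le_trans (ler_norm _)); rewrite normrM.
apply: (@le_trans _ _ (`|sg| * (k * (s * `|v|)))); first exact: ler_wpM2l.
have -> : `|sg| * (k * (s * `|v|)) = s * (k * (`|sg| * `|v|)) by ring.
rewrite ler_pM2l// /k mulrAC ler_pdivrMr// ler_pM2l//.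
by rewrite lerDr.
Qed.

Lemma convex_set_segment X u v (s : R) : convex_set X -> X u -> X v ->
  0 <= s <= 1 -> X (s *: (u - v) + v).
Proof.
move=> cX Xu Xv /andP[s0 s1].
have := cX u v (Itv01 s0 s1); rewrite !inE => /(_ Xu Xv) /=.
congr (X _); rewrite {1}/conv/= /unstable.onem.
by rewrite scalerBl scale1r scalerBr -addrA [_ + v]addrC.
Qed.

Lemma convex_function_segment D psi u v (s : R) : convex_function D psi ->
  D u -> D v -> 0 <= s <= 1 ->
  psi (s *: (u - v) + v) <= psi v + s * (psi u - psi v).
Proof.
move=> cpsi Du Dv /andP[s0 s1].
have := cpsi (Itv01 s0 s1) u v; rewrite !inE => /(_ Du Dv) /=.
rewrite convRE {1}/conv/= /unstable.onem.
have -> : s *: u + (1 - s) *: v = s *: (u - v) + v.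
  by rewrite scalerBl scale1r scalerBr -addrA [_ + v]addrC.
lra.
Qed.

(** On the segment from [y] to [x], [psi] lies below its chord; dividing by [s] and letting [s]
    vanish gives the tangent inequality. *)
Lemma bregman_ge0 D psi x y : convex_function D psi -> D x -> D y ->
  differentiable psi y -> 0 <= bregman psi x y.
Proof.
move=> cpsi Dx Dy dpsi; rewrite /bregman subr_ge0.
have : psi y - psi x <= -1 * inner (gradient psi y) (x - y).
  apply: gradient_ge => // s /andP[s0 s1].
  have := @convex_function_segment _ _ x y s cpsi Dx Dy.
  by rewrite (ltW s0) (ltW s1) => /(_ isT); lra.
lra.
Qed.

(** On the segment from [u] to [x] the objective of the step is smallest at [u], so its one-sided
    derivative there is nonnegative. The three-point identity of Bregman divergences rewrites the
    resulting difference of gradients. *)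
Lemma mirror_step_optimality psi X (eta : R) g y u x : convex_set X ->
  mirror_step psi X eta g y u -> differentiable psi u -> X x ->
  inner g (u - x) <=
    eta^-1 * (bregman psi x y - bregman psi x u - bregman psi u y).
Proof.
move=> cX [Xu umin] du Xx.
have : eta^-1 * inner (gradient psi y) (x - u) - inner g (x - u) <=
    eta^-1 * inner (gradient psi u) (x - u).
  apply: gradient_ge => // s /andP[s0 s1].
  have := umin (s *: (x - u) + u).
  move=> /(_ (convex_set_segment cX Xx Xu _)).
  rewrite (ltW s0) (ltW s1) => /(_ isT).
  have E p w : inner p (s *: w + u) = s * inner p w + inner p u.
    by rewrite innerDr innerZr.
  by rewrite /bregman !(innerBr _ _ y) !E; lra.
rewrite /bregman !innerBr; lra.
Qed.

(** Since B_h(x;y) - B_h(u;y) = h(x) - h(u) + <grad h(y), u - x>, optimality gives the claim up to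
    the extra term B_h(u;y) - B_psi(u;y) / eta. That term is at most 0 by relative smoothness, L <=
    1 / eta and B_psi(u;y) >= 0. *)
Lemma mirror_step_bregman_le psi X D (L eta : R) h y u x :
  convex_set X -> X `<=` D -> convex_function D psi ->
  (forall y, D° y -> differentiable psi y) ->
  0 < L -> 0 < eta -> eta <= 1 / L -> rel_smooth psi X D L h ->
  X y -> D° y -> D° u -> X x ->
  mirror_step psi X eta (gradient h y) y u ->
  bregman h x y + eta^-1 * bregman psi x u <=
    h x - h u + eta^-1 * bregman psi x y.
Proof.
move=> cX XD cpsi dpsi L0 eta0 etaL sm Xy Dy Du Xx st.
have Xu : X u by case: st.
have := mirror_step_optimality cX st (dpsi _ Du) Xx.
have := sm u y Xu Xy Dy.
have B0 : 0 <= bregman psi u y.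
  by apply: (bregman_ge0 cpsi) => //; [exact: XD|exact: XD|exact: dpsi].
have : L * bregman psi u y <= eta^-1 * bregman psi u y.
  apply: ler_wpM2r => //; rewrite -[L]invrK lef_pV2 ?posrE ?invr_gt0//.
  by rewrite -div1r.
rewrite {2}/bregman !mulrBr /(bregman h) !innerBr; lra.
Qed.

End deterministic_step.

(** * Measurability of gradients along random points *)

Section joint_measurability.
Context (R : realType) (d : nat).
Implicit Types (h : 'rV[R]_d -> R) (u v y g : 'rV[R]_d).

Lemma continuous_inner g : continuous (inner g).
Proof.
rewrite /inner; apply: (@continuous_big _ _ +%R) => [|i _ v].
  by move=> [? ?]; exact: add_continuous.
have := cvgM (cvg_cst (g ord0 i)) (@coord_continuous R 1 d ord0 i v).
exact.
Qed.

(** The direction may vary with [n], as it does once points are rounded to a grid: differentiability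
    controls the remainder uniformly over bounded directions. *)
Lemma difference_quotient_cvg h y v (w : nat -> 'rV[R]_d) :
  differentiable h y -> w n @[n --> \oo] --> v ->
  (n.+1%:R * (h (n.+1%:R^-1 *: w n + y) - h y)) @[n --> \oo]
    --> inner (gradient h y) v.
Proof.
move=> dh wv.
have gw : inner (gradient h y) (w n) @[n --> \oo] --> inner (gradient h y) v.
  by apply: continuous_cvg => //; exact: continuous_inner.
have iw : (n.+1%:R^-1 *: w n) @[n --> \oo] --> (0 : 'rV[R]_d).
  by have := cvgZ (@cvg_harmonic R) wv; rewrite scale0r; exact.
suff rem : (n.+1%:R * (h (n.+1%:R^-1 *: w n + y) - h y)
    - inner (gradient h y) (w n)) @[n --> \oo] --> 0.
  rewrite -[X in _ --> X]add0r.
  apply: cvg_trans (cvgD rem gw); apply: near_eq_cvg; apply: nearW => n /=.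
  by rewrite /= subrK.
apply/cvgrPdist_le => e e0.
pose k := e / (`|v| + 1).
have v1 : 0 < `|v| + 1 by rewrite ltr_wpDl.
have k0 : 0 < k by rewrite divr_gt0.
have nw : \forall n \near \oo, `|w n| <= `|v| + 1.
  have /cvgrPdist_le /(_ 1 ltr01) := wv; apply: filterS => n vw.
  by rewrite -[w n](subrK v) (le_trans (ler_normD _ _))// addrC lerD2l distrC.
have := iw _ (gradient_expansion dh k0).
rewrite near_simpl; move: nw; apply: filterS2 => n wn.
rewrite /= innerZr normrZ gtr0_norm ?invr_gt0// sub0r normrN => H.
have n0 : (n.+1%:R : R) != 0 by rewrite pnatr_eq0.
have -> : n.+1%:R * (h (n.+1%:R^-1 *: w n + y) - h y) -
   inner (gradient h y) (w n) = n.+1%:R * (h (n.+1%:R^-1 *: w n + y) - h y -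
   n.+1%:R^-1 * inner (gradient h y) (w n)).
  by rewrite [RHS]mulrBr mulVKf.
rewrite normrM normr_nat; apply: (@le_trans _ _ (k * `|w n|)).
  apply: le_trans (ler_wpM2l (ler0n _ _) H) _.
  by rewrite mulrCA mulVKf.
by rewrite /k mulrAC ler_pdivrMr// ler_pM2l.
Qed.

(** Rounding goes through integer vectors because these form a countable type, which makes
    evaluation at a rounded random point measurable. *)
Definition grid_index (N : nat) y : 'rV[int]_d :=
  \row_i Num.floor (N%:R * y ord0 i).

Definition grid_point (N : nat) (m : 'rV[int]_d) : 'rV[R]_d :=
  \row_i ((m ord0 i)%:~R / N%:R).

Lemma grid_pointP N y : (0 < N)%N ->
  `|grid_point N (grid_index N y) - y| <= N%:R^-1.
Proof.
move=> N0; have N0R : 0 < (N%:R : R) by rewrite ltr0n.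
rewrite [leLHS]mx_normrE; apply: bigmax_le => [|[i j] _].
  by rewrite invr_ge0.
rewrite !mxE /= (ord1 i).
have /andP[] := floor_itv (N%:R * y ord0 j).
rewrite intrD; set f := (Num.floor _)%:~R => f1 f2.
rewrite -[y ord0 j](mulKf (lt0r_neq0 N0R)) [_ / _]mulrC -mulrBr normrM.
rewrite gtr0_norm ?invr_gt0// ger_pMr ?invr_gt0// ler_norml; lra.
Qed.

Context dT (T : measurableType dT).

(** A preimage is the countable union, over the values [m] of [k], of the pieces on which [k] equals
    [m]. *)
Lemma measurable_fun_countable_choice (I : countType) (k : T -> I)
    (a : I -> T -> R) :
  (forall m, measurable (k @^-1` [set m])) ->
  (forall m, measurable_fun setT (a m)) ->
  measurable_fun setT (fun p => a (k p) p).
Proof.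
move=> mk ma _ B mB; rewrite setTI.
have -> : (fun p => a (k p) p) @^-1` B =
    \bigcup_(m in [set: I]) (k @^-1` [set m] `&` a m @^-1` B).
  apply/seteqP; split => [p Bp|p [m _ [<-]]//].
  by exists (k p).
apply: countable_bigcupT_measurable => [|m]; first exact: countableP.
apply: measurableI; first exact: mk.
by rewrite -[X in measurable X]setTI; exact: ma.
Qed.

Lemma measurable_grid_index (u : T -> 'rV[R]_d) N (m : 'rV[int]_d) :
  (forall i, measurable_fun setT (fun p => u p ord0 i)) ->
  measurable ((fun p => grid_index N (u p)) @^-1` [set m]).
Proof.
move=> u_meas; have -> : (fun p => grid_index N (u p)) @^-1` [set m] =
   \bigcap_(i in [set: 'I_d])
     (fun p => N%:R * u p ord0 i) @^-1` `[(m ord0 i)%:~R, (m ord0 i + 1)%:~R[.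
  apply/seteqP; split => p /=.
    by move=> <- i _ /=; rewrite in_itv/= !mxE floor_itv.
  move=> H; apply/rowP => i; rewrite mxE; apply: floor_def.
  by have := H i I; rewrite /= in_itv.
apply: fin_bigcap_measurable => [|i _]; first exact: finite_finset.
rewrite -[X in measurable X]setTI.
by apply: measurable_funM => //; exact: u_meas.
Qed.

Context (h : T -> 'rV[R]_d -> R).

(* The values of [h] at grid points where [h ^~ y] is not measurable are
   discarded; near the points of interest there are none. *)
Definition grid_approx (c : T -> 'rV[R]_d) N p : R :=
  let y := grid_point N (grid_index N (c p)) in
  if `[< measurable_fun setT (h ^~ y) >] then h p y else 0.

Lemma measurable_grid_approx (c : T -> 'rV[R]_d) N :
  (forall i, measurable_fun setT (fun p => c p ord0 i)) ->
  measurable_fun setT (grid_approx c N).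
Proof.
move=> mc.
pose a (m : 'rV[int]_d) p : R :=
  if `[< measurable_fun setT (h ^~ (grid_point N m)) >]
  then h p (grid_point N m) else 0.
apply: (@measurable_fun_countable_choice _ (fun p => grid_index N (c p)) a).
  by move=> m; exact: measurable_grid_index.
move=> m; rewrite /a; case: asboolP => [//|_]; exact: measurable_cst.
Qed.

Context (u : T -> 'rV[R]_d).
Hypothesis u_meas : forall i, measurable_fun setT (fun p => u p ord0 i).
Hypothesis hm : forall p, \forall y \near u p, measurable_fun setT (h ^~ y).
Hypothesis hd : forall p, differentiable (h p) (u p).

Lemma grid_approx_near (c : nat -> T -> 'rV[R]_d) (N : nat -> nat) p :
  grid_point (N n) (grid_index (N n) (c n p)) @[n --> \oo] --> u p ->
  \forall n \near \oo, grid_approx (c n) (N n) p =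
    h p (grid_point (N n) (grid_index (N n) (c n p))).
Proof.
move=> cu; have : \forall n \near \oo, measurable_fun setT
    (h ^~ (grid_point (N n) (grid_index (N n) (c n p)))) by exact: cu (hm p).
apply: filterS => n mn.
by rewrite /grid_approx asboolT.
Qed.

(** Limit of the values of [h p] at grid points approaching [u p], by continuity of [h p] at that
    point. *)
Lemma measurable_fun_diff_point : measurable_fun setT (fun p => h p (u p)).
Proof.
apply: (@measurable_fun_cvg _ _ _ _ (fun n => grid_approx u n.+1)) => [n|p _].
  exact: measurable_grid_approx.
have gu : grid_point n.+1 (grid_index n.+1 (u p)) @[n --> \oo] --> u p.
  apply/cvgrPdist_le => e e0.
  have /cvgrPdist_le /(_ _ e0) := @cvg_harmonic R; apply: filterS => n.
  rewrite sub0r normrN distrC => /(le_trans _); apply.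
  exact: le_trans (grid_pointP _ _) (ler_norm _).
have hgu : h p (grid_point n.+1 (grid_index n.+1 (u p))) @[n --> \oo]
    --> h p (u p).
  by apply: continuous_cvg => //; exact: differentiable_continuous.
apply: cvg_trans hgu.
apply: near_eq_cvg; have := grid_approx_near (c := fun=> u) gu.
by apply: filterS => n /= ->.
Qed.

(* [h p] need not be regular away from [u p], so its difference quotients are
   taken at grid points of mesh 1/n^2, which is negligible against the step
   1/n; these points take countably many values. *)
Lemma measurable_fun_inner_gradient v :
  measurable_fun setT (fun p => inner (gradient (h p) (u p)) v).
Proof.
pose c n p := u p + n.+1%:R^-1 *: v.
pose N n := (n.+1 * n.+1)%N.
apply: (@measurable_fun_cvg _ _ _ _
    (fun n p => n.+1%:R * (grid_approx (c n) (N n) p - h p (u p)))) => [n|p _].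
  apply: measurable_funM => //; apply: measurable_funB.
    apply: measurable_grid_approx => i.
    rewrite (_ : (fun p => _) = (fun p => u p ord0 i + n.+1%:R^-1 * v ord0 i)).
      by apply: measurable_funD => //; exact: u_meas.
    by apply/funext => p; rewrite !mxE.
  exact: measurable_fun_diff_point.
pose y n := grid_point (N n) (grid_index (N n) (c n p)).
(* [w n] is the direction that leads from [u p] to the rounded point [y n] in a step of length
   1/(n+1). A rounding error of at most 1/(n+1)^2 shifts this direction from [v] by at most
   1/(n+1). *)
pose w n := n.+1%:R *: (y n - u p).
have yE n : y n = n.+1%:R^-1 *: w n + u p.
  by rewrite /w scalerA mulVf ?pnatr_eq0// scale1r subrK.
have wv : w n @[n --> \oo] --> v.
  apply/cvgrPdist_le => e e0.
  have /cvgrPdist_le /(_ _ e0) := @cvg_harmonic R; apply: filterS => n.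
  rewrite sub0r normrN distrC => /(le_trans _); apply.
  have -> : w n - v = n.+1%:R *: (y n - c n p).
    rewrite /w /c opprD addrA (scalerBr _ (_ - _)) scalerA.
    by rewrite mulfV ?pnatr_eq0// scale1r.
  apply: le_trans (ler_norm _); rewrite normrZ normr_nat /harmonic.
  rewrite -ler_pdivlMl ?ltr0n// -invfM -natrM; exact: grid_pointP.
have yu : y n @[n --> \oo] --> u p.
  under eq_fun do rewrite yE.
  have := cvgD (cvgZ (@cvg_harmonic R) wv) (cvg_cst (u p)).
  by rewrite scale0r add0r; exact.
apply: cvg_trans (difference_quotient_cvg (hd p) wv).
apply: near_eq_cvg; have := grid_approx_near yu.
by apply: filterS => n /= ->; rewrite -/(y n) yE.
Qed.

End joint_measurability.

(** * Integration against independent variables *)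

Section freezing.
Context (R : realType) (dO d1 d2 : measure_display) (Omega : measurableType dO)
  (T1 : measurableType d1) (T2 : measurableType d2) (P : probability Omega R)
  (Y : {RV P >-> T1}) (Z : {RV P >-> T2}).
Hypothesis YZ : forall A B, measurable A -> measurable B ->
  P (Y @^-1` A `&` Z @^-1` B) = (P (Y @^-1` A) * P (Z @^-1` B))%E.

Let YZpair (w : Omega) : T1 * T2 := (Y w, Z w).

Let measurable_YZpair : measurable_fun setT YZpair.
Proof. by apply: measurable_fun_pair; exact: measurable_funP. Qed.

HB.instance Definition _ :=
  isMeasurableFun.Build _ _ _ _ YZpair measurable_YZpair.

Let PYZ : {measure set (T1 * T2) -> \bar R} := distribution P YZpair.

Let PYZE C : measurable C ->
  (distribution P Y \x distribution P Z)%E C = PYZ C.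
Proof. by apply: product_measure_unique => A B mA mB; rewrite -YZ. Qed.

Let PYZI (f : T1 * T2 -> \bar R) :
  (\int[distribution P Y \x distribution P Z]_z f z =
   \int[distribution P YZpair]_z f z)%E.
Proof. by apply: eq_measure_integral => A mA _; exact: PYZE. Qed.

(** The uniform bound [C] makes [Phi] integrable for the product of the two laws, by Tonelli.
    Independence identifies that product with the law of the pair, and Fubini freezes the first
    variable. *)
Lemma independent_integral (Phi : T1 * T2 -> R) (C : R) :
  measurable_fun setT Phi ->
  (forall y, \int[distribution P Z]_z `|(Phi (y, z))%:E| <= C%:E)%E ->
  P.-integrable setT (fun w => (Phi (Y w, Z w))%:E) /\
  (\int[P]_w (Phi (Y w, Z w))%:E =
    \int[P]_w \int[distribution P Z]_z (Phi (Y w, z))%:E)%E.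
Proof.
move=> mPhi PhiC.
have mEPhi : measurable_fun setT (EFin \o Phi) by exact/measurable_EFinP.
have iPhi : (distribution P Y \x distribution P Z)%E.-integrable setT
    (EFin \o Phi).
  apply/integrable12ltyP => //.
  apply: (@le_lt_trans _ _ (\int[distribution P Y]_y C%:E)%E).
    apply: ge0_le_integral => //.
    - by move=> y _; exact: integral_ge0.
    - apply: (measurable_fun_fubini_tonelli_F (abse \o (EFin \o Phi))) => //=.
      exact: measurableT_comp.
    - by move=> y _; exact: PhiC.
  by rewrite integral_cst// [X in (_ * X)%E]probability_setT mule1 ltry.
have iP : P.-integrable setT (fun w => (Phi (Y w, Z w))%:E).
  apply/integrableP; split.
    by apply: (measurableT_comp mEPhi); exact: measurable_YZpair.
  have /integrableP[_] := iPhi.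
  rewrite PYZI ge0_integral_distribution//.
  exact: measurableT_comp.
split => //.
have <- := @integral_distribution _ _ _ _ _ P YZpair (EFin \o Phi) mEPhi iP.
rewrite -PYZI -integral12_prod_meas1//.
have mF := measurable_fubini_F iPhi.
rewrite integral_distribution//.
apply: (@le_integrable _ _ _ _ _ _ _ (cst C%:E)) => //.
- by apply: (measurableT_comp mF).
- move=> w _ /=; apply: (le_trans (le_abse_integral _ _ _)) => //.
    exact: measurableT_comp.
  by apply: (le_trans (PhiC _)); rewrite lee_fin ler_norm.
- exact: finite_measure_integrable_cst.
Qed.

(** Multiplying [Phi] by the indicator of [A] makes the bound hold for all [y], which reduces the
    localized statement to the global one. *)
Lemma independent_integral_on (A : set T1) (Phi : T1 * T2 -> R) (m : T1 -> R)
    (C : R) :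
  measurable A -> measurable_fun setT Phi -> 0 <= C ->
  (forall y, A y -> \int[distribution P Z]_z `|(Phi (y, z))%:E| <= C%:E)%E ->
  (forall y, A y -> \int[distribution P Z]_z (Phi (y, z))%:E = (m y)%:E)%E ->
  P.-integrable (Y @^-1` A) (fun w => (Phi (Y w, Z w))%:E) /\
  (\int[P]_(w in Y @^-1` A) (Phi (Y w, Z w))%:E =
    \int[P]_(w in Y @^-1` A) (m (Y w))%:E)%E.
Proof.
move=> mA mPhi C0 PhiC Phim.
have mYA : measurable (Y @^-1` A).
  by rewrite -[X in measurable X]setTI; exact: measurable_funP.
pose PhiA (p : T1 * T2) := \1_A p.1 * Phi p.
have mPhiA : measurable_fun setT PhiA.
  apply: measurable_funM => //.
  have mI : measurable_fun setT (\1_A : T1 -> R) by exact: measurable_indic.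
  exact: (measurableT_comp mI measurable_fst).
have [i1 E1] : P.-integrable setT (fun w => (PhiA (Y w, Z w))%:E) /\
    (\int[P]_w (PhiA (Y w, Z w))%:E =
      \int[P]_w \int[distribution P Z]_z (PhiA (Y w, z))%:E)%E.
  apply: (@independent_integral _ C) => // y; rewrite /PhiA /= indicE.
  have [/set_mem Ay|_] := boolP (y \in A).
    by under eq_integral do rewrite mul1r; exact: PhiC.
  by rewrite integral0_eq ?lee_fin// => z _; rewrite mul0r normr0.
have PhiAE : (fun w => (PhiA (Y w, Z w))%:E) =
    (fun w => (Phi (Y w, Z w))%:E) \_ (Y @^-1` A).
  by apply/funext => w; rewrite epatch_indic /PhiA /= -EFinM mulrC.
split; first by apply/(integrable_mkcond _ mYA); rewrite -PhiAE.
rewrite integral_mkcond -PhiAE E1 [RHS]integral_mkcond.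
apply: eq_integral => w _; rewrite patchE /PhiA /= indicE.
have -> : (w \in Y @^-1` A) = (Y w \in A) by apply/idP/idP; rewrite !inE.
have [/set_mem Aw|_] := boolP (Y w \in A).
  by under eq_integral do rewrite mul1r; exact: Phim.
by rewrite integral0_eq// => z _; rewrite mul0r.
Qed.

End freezing.

(** * Integrability from one-sided and almost sure bounds *)

Section integrability.
Local Open Scope ereal_scope.
Context d (T : measurableType d) (R : realType) (P : probability T R).

Lemma integrable_posneg (f : T -> \bar R) : measurable_fun setT f ->
  \int[P]_w f^\+ w < +oo -> \int[P]_w f^\- w < +oo -> P.-integrable setT f.
Proof.
move=> mf fp fn; apply/integrableP; split => //.
have -> : \int[P]_w `|f w| = \int[P]_w (f^\+ w + f^\- w).
  by apply: eq_integral => w _; rewrite -[LHS]/((abse \o f) w) fune_abse.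
rewrite ge0_integralD//; first exact: lte_add_pinfty.
- exact: measurable_funepos.
- exact: measurable_funeneg.
Qed.

(** The maximum [k] of [f] and [g] equals [g] almost everywhere, hence is integrable, and dominates
    [f] at every point; with the lower bound [c] this controls the absolute value of [f]. *)
Lemma ae_le_integral (D : set T) (f g : T -> R) (c : R) :
  measurable D -> measurable_fun D f -> P.-integrable D (EFin \o g) ->
  (forall w, D w -> (c <= f w)%R) ->
  {ae P, forall w, D w -> (f w <= g w)%R} ->
  P.-integrable D (EFin \o f) /\
  \int[P]_(w in D) (f w)%:E <= \int[P]_(w in D) (g w)%:E.
Proof.
move=> mD mf ig cf fg; pose k w := Num.max (f w) (g w).
have mg : measurable_fun D g by have /measurable_EFinP := measurable_int _ ig.
have mk : measurable_fun D (EFin \o k).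
  by apply/measurable_EFinP; exact: measurable_maxr.
have kg : ae_eq P D (EFin \o k) (EFin \o g).
  by apply: filterS fg => w fgw Dw; rewrite /= /k max_r// fgw.
have ik : P.-integrable D (EFin \o k).
  apply/integrableP; split => //; have /integrableP[_] := ig.
  rewrite (ae_eq_integral (abse \o (EFin \o g)) (abse \o (EFin \o k)))//.
  - exact: measurableT_comp.
  - by apply: measurableT_comp => //; exact: measurable_int ig.
  - exact: ae_eq_comp.
have iF : P.-integrable D (EFin \o f).
  apply: (@le_integrable _ _ _ _ _ _ _ (fun w => `|c|%:E + `|(k w)%:E|)) => //.
  - exact/measurable_EFinP.
  - move=> w Dw /=; rewrite !lee_fin; have := cf _ Dw.
    have : (f w <= k w)%R by rewrite /k le_max lexx.
    have := ler_norm (k w); have := ler_norm (- c)%R; rewrite normrN.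
    have := normr_ge0 c; have := normr_ge0 (k w).
    rewrite (ger0_norm (_ : 0 <= `|c| + `|k w|)%R) ?addr_ge0// ler_norml; lra.
  - apply: integrableD => //; last exact: integrable_abse.
    exact: finite_measure_integrable_cst.
split => //.
rewrite -(ae_eq_integral (EFin \o g) (EFin \o k))//.
  2: exact: measurable_int ig.
by apply: le_integral => // w _; rewrite lee_fin le_max lexx.
Qed.

End integrability.

Lemma ae_distribution d d' (T : measurableType d) (T' : measurableType d')
    (R : realType) (P : probability T R) (mu : probability T' R)
    (Z : {RV P >-> T'}) (Q : T' -> Prop) :
  (forall A, measurable A -> distribution P Z A = mu A) ->
  {ae mu, forall z, Q z} -> {ae P, forall w, Q (Z w)}.
Proof.
move=> ZE [N [mN N0 QN]]; exists (Z @^-1` N); split.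
- by rewrite -[X in measurable X]setTI; exact: measurable_funP.
- by have := ZE _ mN; rewrite N0.
- by move=> w /= /QN.
Qed.

(** * Independence of the past *)

Section past_independence.
Context (R : realType) (dXi dO : measure_display)
  (Xi : measurableType dXi) (Omega : measurableType dO)
  (P : probability Omega R) (xi : nat -> {RV P >-> Xi}).

Lemma past_measurable t : past xi t `<=` measurable.
Proof.
apply: smallest_sub; first exact: sigma_algebra_measurable.
by move=> _ [s _ [B mB <-]]; exact: measurable_funP.
Qed.

Lemma subset_past s t : (s <= t)%N -> past xi s `<=` past xi t.
Proof.
move=> st; apply: sub_sigma_algebra2; move=> B [r /= /andP[r0 rs] rB].
by exists r => //=; rewrite r0 (leq_trans rs).
Qed.

(** A pi-system for the samples 1 to [t], hence for [past xi t.+1]. The index range is fixed so that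
    intersections are taken factor by factor; unconstrained samples get [setT]. *)
Definition cylinder t : set (set Omega) :=
  [set \bigcap_(j in [set` iota 1 t]) (xi j @^-1` A j) |
    A in [set A : nat -> set Xi | forall j, measurable (A j)]].

Let cylinder_setI t : setI_closed (cylinder t).
Proof.
move=> _ _ [A mA <-] [B mB <-]; exists (fun j => A j `&` B j).
  by move=> j; exact: measurableI.
by rewrite -bigcapI.
Qed.

Let cylinder_measurable t : cylinder t `<=` measurable.
Proof.
move=> _ [A mA <-]; apply: fin_bigcap_measurable => //.
by move=> j _; rewrite -[X in measurable X]setTI; exact: measurable_funP.
Qed.

Let past_cylinder t : past xi t.+1 `<=` <<s cylinder t >>.
Proof.
apply: smallest_sub; first exact: smallest_sigma_algebra.
move=> _ [s /= /andP[s0 st] [B mB <-]]; apply: sub_sigma_algebra.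
exists (fun j => if j == s then B else setT); first by move=> j; case: ifP.
apply/seteqP; split => [w wA|w /= [_ wB] j _ /=].
  by have := wA s; rewrite /= eqxx mem_iota s0 add1n => /(_ st).
by have [->|] := eqVneq j s.
Qed.

(** For fixed [B], both sides are finite measures in [A]. Mutual independence makes them agree on
    cylinders, hence on the generated sigma-algebra. *)
Lemma past_independent t (A : set Omega) (B : set Xi) :
  mutually_independent xi -> (0 < t)%N -> past xi t A -> measurable B ->
  P (A `&` xi t @^-1` B) = (P A * P (xi t @^-1` B))%E.
Proof.
move=> ind; case: t => // t _ pA mB; set E := xi t.+1 @^-1` B.
have mE : measurable E.
  by rewrite -[X in measurable X]setTI; exact: measurable_funP.
have PE0 : (0 <= fine (P E)) by exact: fine_ge0.
have PEfin : P E = (fine (P E))%:E by rewrite fineK// fin_num_measure.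
pose m1 : {measure set Omega -> \bar R} := mrestr P mE.
pose m2 : {measure set Omega -> \bar R} := mscale (NngNum PE0) P.
suff : m1 A = m2 A by rewrite /m1 /m2 /= /mrestr /mscale /= -PEfin muleC.
apply: (@g_sigma_algebra_measure_unique _ _ _ (cylinder t) _ (fun=> setT)).
- exact: cylinder_measurable.
- move=> _; exists (fun=> setT) => //.
  by apply/seteqP; split => // w _ j.
- by apply/seteqP; split => // w _; exists 0%N.
- exact: cylinder_setI.
- move=> _ [C mC <-]; rewrite /m1 /m2 /= /mrestr /mscale /= -PEfin.
  have iota0 n : {in iota 1 n, forall j, (0 < j)%N}.
    by move=> j; rewrite mem_iota => /andP[].
  rewrite (ind _ _ (iota_uniq 1 t) (@iota0 t) mC).
  (* Adding [B] as the factor at [t.+1] turns the intersection into a cylinder over one more sample,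
     to which mutual independence applies again. *)
  pose C' j := if j == t.+1 then B else C j.
  have mC' j : measurable (C' j) by rewrite /C'; case: ifP.
  have C'C j : j \in iota 1 t -> C' j = C j.
    by rewrite mem_iota add1n /C' => /andP[_]; case: eqP => // ->; rewrite ltnn.
  have iotaE : iota 1 t.+1 = iota 1 t ++ [:: t.+1].
    by rewrite -[in LHS](addn1 t) iotaD add1n.
  have -> : \bigcap_(j in [set` iota 1 t]) (xi j @^-1` C j) `&` E =
      \bigcap_(j in [set` iota 1 t.+1]) (xi j @^-1` C' j).
    rewrite iotaE; apply/seteqP; split => w /=.
      move=> [wC wE] j /=; rewrite mem_cat mem_seq1 => /orP[jt|/eqP ->].
        by rewrite C'C//; exact: wC.
      by rewrite /C' eqxx.
    move=> wC; split => [j /= jt|].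
      by have := wC j; rewrite /= mem_cat jt C'C// => /(_ isT).
    have := wC t.+1; rewrite /= mem_cat mem_seq1 eqxx orbT /C' eqxx.
    exact.
  rewrite (ind _ _ (iota_uniq 1 t.+1) (@iota0 t.+1) mC').
  have C'B : C' t.+1 = B by rewrite /C' eqxx.
  rewrite iotaE big_cat big_seq1 /= C'B muleC; congr (_ * _)%E.
  by rewrite big_seq [RHS]big_seq; apply: eq_bigr => j /C'C ->.
- by move=> _; rewrite /m1 /= /mrestr setTI ltey_eq fin_num_measure.
- exact: past_cylinder.
Qed.

End past_independence.

(** * Localized supermartingales *)

Section local_supermartingale_step.
Context (R : realType) (dO d1 : measure_display) (Omega : measurableType dO)
  (T1 : measurableType d1) (P : probability Omega R) (Y : {RV P >-> T1})
  (m tau : T1 -> R) (M' : Omega -> R).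
Hypotheses (mm : measurable_fun setT m) (mtau : measurable_fun setT tau)
  (mM' : measurable_fun setT M').
Local Open Scope ereal_scope.

Let M w : \bar R := (m (Y w))%:E.
Let M1 w : \bar R := (M' w)%:E.

Hypothesis local_step : forall n A, measurable A ->
  (forall y, A y -> (tau y <= n%:R)%R) ->
  [/\ P.-integrable (Y @^-1` A) M, P.-integrable (Y @^-1` A) M1 &
    \int[P]_(w in Y @^-1` A) M1 w <= \int[P]_(w in Y @^-1` A) M w].

Let mM : measurable_fun setT M.
Proof. by apply/measurable_EFinP; exact: measurableT_comp. Qed.

Let mM1 : measurable_fun setT M1.
Proof. exact/measurable_EFinP. Qed.

Let F n := [set y | (tau y <= n%:R)%R].

Let mF n : measurable (F n).
Proof.
by rewrite -[F n]setTI; exact: measurable_fun_le.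
Qed.

Let mY A : measurable A -> measurable (Y @^-1` A).
Proof.
by move=> mA; rewrite -[X in measurable X]setTI; exact: measurable_funP.
Qed.

(** Monotone convergence: the events where [tau] is at most [n] increase to the whole space, as
    [tau] is real-valued. *)
Lemma ge0_integral_le_exhaust (f : Omega -> \bar R) (C : \bar R) :
  measurable_fun setT f -> (forall w, 0 <= f w) ->
  (forall n, \int[P]_(w in Y @^-1` F n) f w <= C) -> \int[P]_w f w <= C.
Proof.
move=> mf f0 fC.
have <- : \bigcup_n (Y @^-1` F n) = setT.
  apply/seteqP; split => // w _.
  exists (Num.truncn `|tau (Y w)|).+1 => //=.
  by rewrite /F /= (le_trans (ler_norm _))// ltW// truncnS_gt.
have nF : nondecreasing_seq (fun n => Y @^-1` F n).
  move=> n k nk; apply/subsetPset => w /= /le_trans; apply.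
  by rewrite ler_nat.
have := @ge0_nondecreasing_set_cvg_integral _ _ R _ f P nF
  (fun n => mY (mF n)) (fun n => measurable_funTS mf) (fun _ w _ => f0 w).
move=> /cvg_lim <- //; apply: lime_le.
  apply: ereal_nondecreasing_is_cvgn.
  exact: (@ge0_nondecreasing_set_nondecreasing_integral _ _ R _ f P nF
    (fun n => mY (mF n)) (fun n => measurable_funTS mf) (fun _ w _ => f0 w)).
by apply: nearW.
Qed.

(** The local inequality rearranged so that only integrals of nonnegative functions occur; these
    have monotone limits even where [M] and [M1] are not globally integrable. *)
Let cross n A : measurable A -> A `<=` F n ->
  \int[P]_(w in Y @^-1` A) M1^\+ w + \int[P]_(w in Y @^-1` A) M^\- w <=
  \int[P]_(w in Y @^-1` A) M^\+ w + \int[P]_(w in Y @^-1` A) M1^\- w.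
Proof.
move=> mA AF; have [iM iM1] := local_step mA AF.
rewrite [leLHS]integralE [leRHS]integralE.
have := integrable_pos_fin_num (mY mA) iM.
have := integrable_neg_fin_num (mY mA) iM.
have := integrable_pos_fin_num (mY mA) iM1.
have := integrable_neg_fin_num (mY mA) iM1.
move=> /fineK <- /fineK <- /fineK <- /fineK <-.
by rewrite -!EFinB -!EFinD !lee_fin; lra.
Qed.

(** Restricting to the event where [m] is nonpositive loses nothing of the negative part of [M] and
    removes its positive part from [cross]. *)
Lemma local_step_funeneg_le : \int[P]_w M^\- w <= \int[P]_w M1^\- w.
Proof.
apply: ge0_integral_le_exhaust => //; first exact: measurable_funeneg.
move=> n; pose B := F n `&` [set y | (m y <= 0)%R].
have mB : measurable B.
  apply: measurableI => //; rewrite -[X in measurable X]setTI.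
  exact: measurable_fun_le.
have -> : \int[P]_(w in Y @^-1` F n) M^\- w = \int[P]_(w in Y @^-1` B) M^\- w.
  rewrite integral_mkcond [RHS]integral_mkcond; apply: eq_integral => w _.
  rewrite /patch; case: ifPn => wF; case: ifPn => //.
    rewrite notin_setE /B /= => wB; rewrite funenegE /M -EFinN -EFin_max.
    congr _%:E; apply/max_idPr; rewrite oppr_le0 leNgt; apply/negP => m0.
    by apply: wB; split; [move: wF; rewrite inE|exact: ltW].
  by move: wF; rewrite notin_setE => wF; rewrite inE => -[].
have /= := @cross n B mB (@subIsetl _ _ _).
rewrite [X in _ <= X + _]integral0_eq ?add0e => [le1|w [_ /= m0]]; last first.
  by rewrite funeposE /M -EFin_max; congr _%:E; apply/max_idPr.
apply: le_trans (le_trans le1 _).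
  by rewrite leeDr// integral_ge0.
apply: ge0_subset_integral => //; first exact: mY.
exact/measurable_funTS/measurable_funeneg.
Qed.

(** In the limit of [cross] every term but the positive part of [M1] is known to be finite, so that
    one is finite too and the inequality can be rearranged back. *)
Lemma local_step_integral_le : P.-integrable setT M ->
  \int[P]_w M1^\- w < +oo ->
  P.-integrable setT M1 /\ \int[P]_w M1 w <= \int[P]_w M w.
Proof.
move=> iM M1neg.
have mp : measurable_fun setT M1^\+ by exact: measurable_funepos.
have mn : measurable_fun setT M1^\- by exact: measurable_funeneg.
have mp' : measurable_fun setT M^\+ by exact: measurable_funepos.
have mn' : measurable_fun setT M^\- by exact: measurable_funeneg.
have le1 : \int[P]_w M1^\+ w + \int[P]_w M^\- w <=
    \int[P]_w M^\+ w + \int[P]_w M1^\- w.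
  rewrite -ge0_integralD//; apply: ge0_integral_le_exhaust.
  - exact: emeasurable_funD.
  - by move=> w; exact: adde_ge0.
  move=> n; rewrite ge0_integralD//; last 3 first.
  - exact: mY.
  - exact: measurable_funTS.
  - exact: measurable_funTS.
  apply: (le_trans (cross (mF n) (@subset_refl _ _))).
  by apply: leeD; apply: ge0_subset_integral => //; exact: mY.
have Mp := integrable_pos_fin_num measurableT iM.
have Mn := integrable_neg_fin_num measurableT iM.
have M1n : \int[P]_w M1^\- w \is a fin_num.
  by rewrite ge0_fin_numE// integral_ge0.
have M1p : \int[P]_w M1^\+ w \is a fin_num.
  rewrite ge0_fin_numE ?integral_ge0//.
  apply: (@le_lt_trans _ _ (\int[P]_w M1^\+ w + \int[P]_w M^\- w)).
    by rewrite leeDl// integral_ge0.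
  by apply: (le_lt_trans le1); rewrite lte_add_pinfty// ltey_eq ?Mp ?M1n.
split.
  by apply: integrable_posneg => //; rewrite -ge0_fin_numE ?integral_ge0.
rewrite [leLHS]integralE [leRHS]integralE; move: le1.
move: Mp Mn M1n M1p => /fineK <- /fineK <- /fineK <- /fineK <-.
by rewrite -!EFinB -!EFinD !lee_fin; lra.
Qed.

End local_supermartingale_step.

(** * Measurability and integrability of Bregman divergences *)

Section measurability_in_past.
Context (R : realType) (d : nat) (dT : measure_display) (T : measurableType dT).
Implicit Types (u : T -> 'rV[R]_d) (h : T -> 'rV[R]_d -> R).

(** Passes from Borel sets of vectors, in which adaptedness is stated, to the coordinates used by
    the grid argument. *)
Lemma measurable_coord u i :
  (forall B, <<s @open 'rV[R]_d >> B -> measurable (u @^-1` B)) ->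
  measurable_fun setT (fun w => u w ord0 i).
Proof.
move=> mu; apply: (measurability _ (RGenOInfty.measurableE R)).
move=> _ [_ [a ->] <-]; rewrite setTI.
have -> : (fun w => u w ord0 i) @^-1` `]a, +oo[ =
    u @^-1` ((fun v : 'rV[R]_d => v ord0 i) @^-1` `]a, +oo[) by [].
apply: mu; apply: sub_sigma_algebra.
have /continuousP cc := @coord_continuous R 1 d ord0 i.
have oa : open (`]a, +oo[%classic : set R) by exact: interval_open.
exact: cc oa.
Qed.

(** The function may depend on [p] as well as the point, so this covers [psi], the mean objective
    and the sampled objective at once. *)
Lemma measurable_fun_bregman u h (a : 'rV[R]_d) :
  (forall i, measurable_fun setT (fun p => u p ord0 i)) ->
  measurable_fun setT (h ^~ a) ->
  (forall p, \forall y \near u p, measurable_fun setT (h ^~ y)) ->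
  (forall p, differentiable (h p) (u p)) ->
  measurable_fun setT (fun p => bregman (h p) a (u p)).
Proof.
move=> mu ma hm hd; apply: measurable_funB.
  by apply: measurable_funB => //; exact: measurable_fun_diff_point.
apply: measurable_sum => i; apply: measurable_funM; last first.
  rewrite (_ : (fun _ => _) = (fun p => a ord0 i - u p ord0 i)).
    exact: measurable_funB.
  by apply/funext => p; rewrite !mxE.
have := measurable_fun_inner_gradient mu hm hd (delta_mx ord0 i).
congr measurable_fun; apply/funext => p.
rewrite /inner (bigD1 i)//= big1 ?addr0 => [|j ji]; rewrite !mxE !eqxx.
  by rewrite mulr1.
by rewrite (negbTE ji) mulr0.
Qed.

End measurability_in_past.

(** * Averages over one sample: Bregman divergences and the optimality gap *)

Section mean_bregman.
Context (R : realType) (d : nat) (dXi : measure_display)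
  (Xi : measurableType dXi) (mu : probability Xi R) (F : Xi -> 'rV[R]_d -> R)
  (X D : set 'rV[R]_d).
Hypothesis obj : stochastic_objective mu F X D.

Lemma integrable_inner_gradient y v : X y -> D° y ->
  mu.-integrable setT (fun z => (inner (gradient (F z) y) v)%:E).
Proof.
move=> Xy Dy; rewrite /inner; under eq_fun do rewrite -sumEFin.
apply: integrable_sum => // i _; under eq_fun do rewrite EFinM muleC.
by apply: integrableZl => //; exact: so_gradient_integrable obj _ _ Xy Dy.
Qed.

Lemma integral_inner_gradient y v : X y -> D° y ->
  (\int[mu]_z (inner (gradient (F z) y) v)%:E)%E =
  (inner (gradient (mean_objective mu F) y) v)%:E.
Proof.
move=> Xy Dy; rewrite /inner; under eq_integral do rewrite -sumEFin.
have iG i := so_gradient_integrable obj i Xy Dy.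
rewrite integral_sum//; last first.
  move=> i; under eq_fun do rewrite EFinM muleC.
  exact: integrableZl.
rewrite -sumEFin; apply: eq_bigr => i _.
under eq_integral do rewrite EFinM muleC.
rewrite integralZl// muleC EFinM; congr (_ * _)%E.
by rewrite -(so_gradient_mean obj i Xy Dy) unlock.
Qed.

Lemma mean_objectiveE x : X x ->
  (\int[mu]_z (F z x)%:E)%E = (mean_objective mu F x)%:E.
Proof.
move=> Xx; rewrite /mean_objective unlock fineK//.
exact/integrable_fin_num/(so_integrable obj Xx).
Qed.

Lemma integrable_bregman a y : X a -> X y -> D° y ->
  mu.-integrable setT (fun z => (bregman (F z) a y)%:E).
Proof.
move=> Xa Xy Dy; rewrite /bregman; under eq_fun do rewrite !EFinB.
apply: integrableB => //; last exact: integrable_inner_gradient.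
by apply: integrableB => //; exact: so_integrable obj _ _.
Qed.

Lemma integral_bregman a y : X a -> X y -> D° y ->
  (\int[mu]_z (bregman (F z) a y)%:E)%E =
  (bregman (mean_objective mu F) a y)%:E.
Proof.
move=> Xa Xy Dy; rewrite /bregman; under eq_integral do rewrite !EFinB.
have iF x : X x -> mu.-integrable setT (EFin \o F ^~ x).
  exact: so_integrable obj _.
rewrite integralB//; last 2 first.
- by apply: integrableB => //; exact: iF.
- exact: integrable_inner_gradient.
rewrite integralB//; [|exact: iF|exact: iF].
by rewrite !mean_objectiveE// integral_inner_gradient.
Qed.

Variable xs : 'rV[R]_d.
Hypotheses (Xxs : X xs) (sigma_fin : (sigma2 mu F X xs < +oo)%E).

(** [fine] replaces an infinite infimum by 0; this happens only on a null set, so the mean of the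
    gap is still sigma^2. *)
Definition sample_gap (z : Xi) : R := F z xs - fine (sample_inf F X z).

Lemma sample_inf_le z x : X x -> (sample_inf F X z <= (F z x)%:E)%E.
Proof. by move=> Xx; apply: ereal_inf_lbound; exists x. Qed.

(** The positive part is bounded by that of [F z xs]. If the negative part had infinite integral,
    the mean infimum would be -oo and sigma^2 would be +oo. *)
Lemma sample_inf_integrable : mu.-integrable setT (sample_inf F X).
Proof.
have iF := so_integrable obj Xxs.
have mI : measurable_fun setT (sample_inf F X) := so_inf_measurable obj.
have Ip : (\int[mu]_z (sample_inf F X)^\+ z < +oo)%E.
  have Fp : (\int[mu]_z (EFin \o F ^~ xs)^\+ z < +oo)%E.
    exact: integral_funepos_lt_pinfty.
  apply: le_lt_trans Fp; apply: ge0_le_integral => //.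
  - exact: measurable_funepos.
  - by apply: measurable_funepos; exact: measurable_int iF.
  - move=> z _; rewrite !funeposE ge_max le_max sample_inf_le//=.
    by rewrite le_max lexx orbT.
have In : (\int[mu]_z (sample_inf F X)^\- z < +oo)%E.
  rewrite ltNge leye_eq; apply/negP => /eqP In.
  move: sigma_fin; rewrite /sigma2 integralE In.
  have /fineK <- : (\int[mu]_z (sample_inf F X)^\+ z)%E \is a fin_num.
    by rewrite ge0_fin_numE// integral_ge0.
  by [].
exact: integrable_posneg.
Qed.

Lemma sample_inf_fin : {ae mu, forall z, sample_inf F X z \is a fin_num}.
Proof.
have := integrable_ae measurableT sample_inf_integrable.
by apply: filterS => z /(_ I).
Qed.

Lemma fine_sample_inf_ae :
  ae_eq mu setT (EFin \o (fine \o sample_inf F X)) (sample_inf F X).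
Proof. by apply: filterS sample_inf_fin => z fz _; rewrite /= fineK. Qed.

Lemma sigma2_fin_num : sigma2 mu F X xs \is a fin_num.
Proof.
rewrite /sigma2 fin_numB/= integrable_fin_num//.
exact: sample_inf_integrable.
Qed.

Lemma sigma2_ge0 : (0 <= sigma2 mu F X xs)%E.
Proof.
have iI := sample_inf_integrable.
rewrite /sigma2 -(mean_objectiveE Xxs) sube_ge0.
  apply: le_integral => //; first exact: so_integrable obj _ Xxs.
  by move=> z _; exact: sample_inf_le.
by rewrite integrable_fin_num.
Qed.

Lemma measurable_fine_sample_inf : measurable_fun setT (fine \o sample_inf F X).
Proof.
by apply: measurableT_comp => //; exact: so_inf_measurable obj.
Qed.

Lemma fine_sample_inf_integrable :
  mu.-integrable setT (EFin \o (fine \o sample_inf F X)).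
Proof.
apply: le_integrable sample_inf_integrable => //.
  exact/measurable_EFinP/measurable_fine_sample_inf.
by move=> z _ /=; case: (sample_inf F X z) => [r||] //=; rewrite normr0 leey.
Qed.

Lemma sample_gap_integrable : mu.-integrable setT (EFin \o sample_gap).
Proof.
rewrite (_ : EFin \o sample_gap =
  (fun z => (EFin \o F ^~ xs) z - (EFin \o (fine \o sample_inf F X)) z)%E) //.
apply: integrableB => //; first exact: so_integrable obj _ _.
exact: fine_sample_inf_integrable.
Qed.

Lemma integral_sample_gap :
  (\int[mu]_z (sample_gap z)%:E)%E = sigma2 mu F X xs.
Proof.
rewrite /sample_gap; under eq_integral do rewrite EFinB.
rewrite integralB//; last 2 first.
- exact: so_integrable obj _ _.
- exact: fine_sample_inf_integrable.
rewrite mean_objectiveE//; congr (_ - _)%E.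
apply: ae_eq_integral fine_sample_inf_ae => //.
  exact/measurable_EFinP/measurable_fine_sample_inf.
exact: so_inf_measurable obj.
Qed.

End mean_bregman.

(** * The mirror descent iterates *)

Section stochastic_mirror_descent.
Context (R : realType) (d : nat)
  (X D : set 'rV[R]_d) (psi : 'rV[R]_d -> R)
  (dXi : measure_display) (Xi : measurableType dXi) (mu : probability Xi R)
  (F : Xi -> 'rV[R]_d -> R)
  (dO : measure_display) (Omega : measurableType dO) (P : probability Omega R)
  (xi : nat -> {RV P >-> Xi})
  (L eta : R) (x1 : 'rV[R]_d) (x : nat -> Omega -> 'rV[R]_d).
Hypotheses (X_convex : convex_set X) (X_sub_D : X `<=` D)
  (psi_convex : convex_function D psi)
  (psi_diff : forall y, D° y -> differentiable psi y)
  (psi_interior : interior_condition psi X D)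
  (obj : stochastic_objective mu F X D)
  (L_gt0 : 0 < L)
  (F_smooth : {ae mu, forall z, rel_smooth psi X D L (F z)})
  (eta_gt0 : 0 < eta) (eta_le : eta <= 1 / L)
  (xi_iid : iid_copies mu xi)
  (x1_X : X x1) (x1_D : D° x1)
  (x_smd : smd_iterates psi X F eta xi x1 x).
Variable xs : 'rV[R]_d.
Hypotheses (Xxs : X xs) (sigma_fin : (sigma2 mu F X xs < +oo)%E).

Lemma iterates_interior t w : (0 < t)%N -> X (x t w) /\ D° (x t w).
Proof.
case: t => // t _; elim: t => [|t [Xt Dt]]; first by rewrite (smd_init x_smd).
have st := smd_step x_smd w (ltn0Sn t).
split; first by case: st.
exact: (psi_interior _ Xt Dt eta_gt0).2 st.
Qed.

Let generators t : set (set Omega) :=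
  \bigcup_(s in [set s | (0 < s < t)%N])
    preimage_set_system setT (xi s) measurable.

(* [Omega] with the sigma-algebra of the past. *)
Let PastT t := g_sigma_algebraType (generators t).

Let to_past t : Omega -> PastT t := id.

Let measurable_to_past t : measurable_fun setT (to_past t).
Proof. by move=> _ B pB; rewrite setTI; exact: past_measurable pB. Qed.

HB.instance Definition _ t :=
  isMeasurableFun.Build _ _ _ _ (to_past t) (@measurable_to_past t).

Let pastT_sub s t (f : Omega -> R) : (s <= t)%N ->
  measurable_fun (setT : set (PastT s)) f ->
  measurable_fun (setT : set (PastT t)) f.
Proof. by move=> st mf mT B mB; apply: (subset_past st); exact: mf. Qed.

Let pastT_Omega t (f : Omega -> R) :
  measurable_fun (setT : set (PastT t)) f -> measurable_fun setT f.
Proof.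
by move=> mf mT B mB; apply: (@past_measurable _ _ _ _ _ _ xi t); exact: mf.
Qed.

Let mean := mean_objective mu F.
Let sigma := fine (sigma2 mu F X xs).
Let V t w := bregman psi xs (x t w).
Let G t w := bregman mean xs (x t w).
Let Psi t (p : PastT t * Xi) := bregman (F p.2) xs (x t p.1).
Let absPsi t (w : Omega) := fine (\int[mu]_z `|(Psi (w : PastT t, z))%:E|)%E.
Let M t w := eta^-1 * V t w + \sum_(1 <= s < t) G s w - t.-1%:R * sigma.
(** All three terms are nonnegative for positive [t], so a bound on [tau] bounds each of them, and
    also [G t], whose absolute value is at most [absPsi t]. *)
Let tau t w := `|M t w| + V t w + absPsi t w.

Let V_ge0 t w : (0 < t)%N -> 0 <= V t w.
Proof.
move=> t0; have [Xt Dt] := iterates_interior w t0.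
by apply: (bregman_ge0 psi_convex) => //; [exact: X_sub_D|exact: X_sub_D|
  exact: psi_diff].
Qed.

Let x_coord t i : (0 < t)%N ->
  measurable_fun (setT : set (PastT t)) (fun w => x t w ord0 i).
Proof.
move=> t0; apply: (@measurable_coord _ _ _ (PastT t)) => B mB.
exact: smd_adapted x_smd _ _ t0 mB.
Qed.

Let measurable_V t : (0 < t)%N -> measurable_fun (setT : set (PastT t)) (V t).
Proof.
move=> t0.
apply: (@measurable_fun_bregman _ _ _ (PastT t) (x t) (fun=> psi)) => //.
- by move=> i; exact: x_coord.
- move=> w; have : nbhs (x t w) setT by exact: filterT.
  by apply: filterS => y _; exact: measurable_cst.
- by move=> w; apply: psi_diff; case: (iterates_interior w t0).
Qed.

Let measurable_G t : (0 < t)%N -> measurable_fun (setT : set (PastT t)) (G t).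
Proof.
move=> t0.
apply: (@measurable_fun_bregman _ _ _ (PastT t) (x t) (fun=> mean)) => //.
- by move=> i; exact: x_coord.
- move=> w; have : nbhs (x t w) setT by exact: filterT.
  by apply: filterS => y _; exact: measurable_cst.
- move=> w; have [Xt Dt] := iterates_interior w t0.
  exact: so_mean_differentiable obj _ Xt Dt.
Qed.

Let measurable_Psi t : (0 < t)%N -> measurable_fun setT (@Psi t).
Proof.
move=> t0.
have mF y : mu.-integrable setT (EFin \o F ^~ y) ->
    measurable_fun setT (fun p : PastT t * Xi => F p.2 y).
  move=> /(measurable_int mu)/measurable_EFinP iF.
  exact: (measurableT_comp iF measurable_snd).
apply: (@measurable_fun_bregman _ _ _ _ (fun p : PastT t * Xi => x t p.1)
  (fun p => F p.2)) => //.
- by move=> i; exact: (measurableT_comp (x_coord i t0) measurable_fst).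
- exact: mF (so_integrable obj Xxs).
- move=> p; have [Xt Dt] := iterates_interior p.1 t0.
  by apply: filterS (so_integrable_near obj Xt Dt) => y; exact: mF.
- move=> p; have [Xt Dt] := iterates_interior p.1 t0.
  exact: so_differentiable obj _ _ Xt Dt.
Qed.

Let integrable_Psi t w : (0 < t)%N ->
  mu.-integrable setT (fun z => (Psi (w : PastT t, z))%:E).
Proof.
move=> t0; have [Xt Dt] := iterates_interior w t0.
exact: (integrable_bregman obj Xxs Xt Dt).
Qed.

Let integral_Psi t w : (0 < t)%N ->
  (\int[mu]_z (Psi (w : PastT t, z))%:E = (G t w)%:E)%E.
Proof.
move=> t0; have [Xt Dt] := iterates_interior w t0.
exact: (integral_bregman obj Xxs Xt Dt).
Qed.

Let absPsiE t w : (0 < t)%N ->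
  (\int[mu]_z `|(Psi (w : PastT t, z))%:E| = (absPsi t w)%:E)%E.
Proof.
move=> t0; rewrite fineK// integrable_fin_num//.
exact/integrable_abse/integrable_Psi.
Qed.

Let absPsi_ge0 t w : 0 <= absPsi t w.
Proof. by rewrite fine_ge0// integral_ge0. Qed.

Let normG_le t w : (0 < t)%N -> `|G t w| <= absPsi t w.
Proof.
move=> t0; rewrite -lee_fin -absPsiE// -[X in (X <= _)%E]abse_EFin.
rewrite -integral_Psi//.
apply: le_abse_integral => //; exact: measurable_int (integrable_Psi w t0).
Qed.

Let measurable_absPsi t : (0 < t)%N ->
  measurable_fun (setT : set (PastT t)) (absPsi t).
Proof.
move=> t0; apply: measurableT_comp => //.
apply: (measurable_fun_fubini_tonelli_F (abse \o (EFin \o @Psi t))) => //=.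
have /measurable_EFinP mE := measurable_Psi t0.
exact: measurableT_comp.
Qed.

Let measurable_M t : (0 < t)%N -> measurable_fun (setT : set (PastT t)) (M t).
Proof.
move=> t0; apply: measurable_funB; last exact: measurable_cst.
apply: measurable_funD.
  by apply: measurable_funM; [exact: measurable_cst|exact: measurable_V].
(* The guard makes every summand measurable, whatever [s], without changing the sum. *)
rewrite /= (_ : (fun _ => _) = fun w : PastT t =>
    \sum_(1 <= s < t) (if (0 < s <= t)%N then G s w else 0)); last first.
  apply/funext => w; apply: eq_big_nat => s /andP[s0 st].
  by rewrite s0 ltnW.
apply: measurable_sum => s; case: (boolP (0 < s <= t)%N) => [/andP[s0 st]|_].
  exact: (pastT_sub st (measurable_G s0)).
exact: measurable_cst.
Qed.

Let measurable_tau t : (0 < t)%N ->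
  measurable_fun (setT : set (PastT t)) (tau t).
Proof.
move=> t0; apply: measurable_funD; last exact: measurable_absPsi.
apply: measurable_funD; last exact: measurable_V.
by apply: measurableT_comp => //; exact: measurable_M.
Qed.

Let M_succ t w : (0 < t)%N ->
  M t.+1 w = M t w + eta^-1 * (V t.+1 w - V t w) + G t w - sigma.
Proof.
case: t => // t _; rewrite /M big_nat_recr//= -[t.+1%:R]natr1; ring.
Qed.

(** The deterministic inequality at the sample [xi t w], with the value at the next iterate bounded
    below by the infimum. Smoothness and finiteness of the infimum carry over from [mu] to [P]
    because [xi t] has law [mu]. *)
Let one_step t : (0 < t)%N -> {ae P, forall w,
  Psi (w : PastT t, xi t w) + eta^-1 * V t.+1 w <=
  sample_gap F X xs (xi t w) + eta^-1 * V t w}.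
Proof.
move=> t0; have := sample_inf_fin obj Xxs sigma_fin.
move=> /(ae_distribution (fun A => xi_iid.1 t A t0)) fI.
have := ae_distribution (fun A => xi_iid.1 t A t0) F_smooth.
move: fI; apply: filterS2 => w fI sm.
have [Xt Dt] := iterates_interior w t0.
have [Xt1 Dt1] := iterates_interior w (ltn0Sn t).
have := mirror_step_bregman_le X_convex X_sub_D psi_convex psi_diff L_gt0
  eta_gt0 eta_le sm Xt Dt Dt1 Xxs (smd_step x_smd w t0).
move=> /le_trans; apply; rewrite lerD2r lerD2l lerN2 -lee_fin fineK//.
exact: sample_inf_le.
Qed.

Let integral_distribution_xi t (f : Xi -> \bar R) : (0 < t)%N ->
  (\int[distribution P (xi t)]_z f z = \int[mu]_z f z)%E.
Proof.
by move=> t0; apply: eq_measure_integral => A mA _; exact: xi_iid.1.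
Qed.

Let gapC := fine (\int[mu]_z `|(sample_gap F X xs z)%:E|)%E.

Let gapCE : (\int[mu]_z `|(sample_gap F X xs z)%:E| = gapC%:E)%E.
Proof.
rewrite fineK// integrable_fin_num//.
exact/integrable_abse/(sample_gap_integrable obj Xxs sigma_fin).
Qed.

Let sigmaE : (\int[mu]_z (sample_gap F X xs z)%:E = sigma%:E)%E.
Proof.
by rewrite (integral_sample_gap obj Xxs sigma_fin) fineK// (sigma2_fin_num obj).
Qed.

(* Dominates M_{t+1} at z = xi_t by [one_step]; its mean over z is M_t. *)
Let Phi t (p : PastT t * Xi) :=
  M t p.1 + G t p.1 - sigma + (sample_gap F X xs p.2 - Psi p).

Let measurable_Phi t : (0 < t)%N -> measurable_fun setT (@Phi t).
Proof.
move=> t0; have mG := sample_gap_integrable obj Xxs sigma_fin.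
have /measurable_EFinP mW := measurable_int _ mG.
apply: measurable_funD.
  apply: measurable_funB => //; apply: measurable_funD.
    exact: (measurableT_comp (measurable_M t0) measurable_fst).
  exact: (measurableT_comp (measurable_G t0) measurable_fst).
apply: measurable_funB; last exact: measurable_Psi.
exact: (measurableT_comp mW measurable_snd).
Qed.

Let integral_Phi t w : (0 < t)%N ->
  (\int[mu]_z (Phi (w : PastT t, z))%:E = (M t w)%:E)%E.
Proof.
move=> t0; rewrite /Phi /=.
have iW := sample_gap_integrable obj Xxs sigma_fin.
have iPsi := integrable_Psi w t0.
have iWP : mu.-integrable setT
    (fun z => (sample_gap F X xs z - Psi (w : PastT t, z))%:E).
  by under eq_fun do rewrite EFinB; exact: integrableB.
under eq_integral do rewrite EFinD.
rewrite integralD//; last exact: finite_measure_integrable_cst.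
rewrite integral_cst// [X in (_ * X)%E]probability_setT mule1.
under [X in (_ + X)%E]eq_integral do rewrite EFinB.
rewrite integralB// sigmaE integral_Psi// -EFinB -EFinD; congr _%:E; ring.
Qed.

Let integral_abs_Phi_le t w : (0 < t)%N ->
  (\int[mu]_z `|(Phi (w : PastT t, z))%:E| <=
    (`|M t w + G t w - sigma| + gapC + absPsi t w)%:E)%E.
Proof.
move=> t0; rewrite !EFinD -gapCE -absPsiE//.
have iW := integrable_abse (sample_gap_integrable obj Xxs sigma_fin).
have iPsi := integrable_abse (integrable_Psi w t0).
have ic : mu.-integrable setT (cst `|M t w + G t w - sigma|%:E).
  exact: finite_measure_integrable_cst.
have -> : (`|M t w + G t w - sigma|%:E =
    \int[mu]_z cst `|M t w + G t w - sigma|%:E z)%E.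
  by rewrite integral_cst// [X in (_ * X)%E]probability_setT mule1.
rewrite -integralD// -integralD//; last exact: integrableD.
have mPhi : measurable_fun setT (fun z => (Phi (w : PastT t, z))%:E).
  apply/measurable_EFinP.
  exact: (measurable_fun_pair2 (w : PastT t) (measurable_Phi t0)).
apply: ge0_le_integral => //.
- exact: measurableT_comp.
- have iR := integrableD measurableT (integrableD measurableT ic iW) iPsi.
  exact: measurable_int iR.
- move=> z _; rewrite /Phi /= lee_fin addrA.
  by rewrite (le_trans (ler_normB _ _))// lerD2r ler_normD.
Qed.

(** Freezing the past shows that [Phi] is integrable on [A] with the same integral as [M t]; then
    [M t.+1] lies between a constant and [Phi]. *)
Let local_step t n A : (0 < t)%N -> measurable (A : set (PastT t)) ->
  (forall w, A w -> tau t w <= n%:R) ->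
  [/\ P.-integrable A (EFin \o M t), P.-integrable A (EFin \o M t.+1) &
    (\int[P]_(w in A) (M t.+1 w)%:E <= \int[P]_(w in A) (M t w)%:E)%E].
Proof.
move=> t0 pA Atau.
have mA : measurable (A : set Omega) by exact: past_measurable pA.
have bound w : A w -> [/\ `|M t w| <= n%:R, V t w <= n%:R,
    absPsi t w <= n%:R & `|G t w| <= n%:R].
  move=> /Atau; rewrite /tau; have := V_ge0 w t0; have := absPsi_ge0 t w.
  have := normG_le w t0; have := normr_ge0 (M t w); split; lra.
have [iPhi PhiM] : P.-integrable A (fun w => (Phi (w : PastT t, xi t w))%:E) /\
    (\int[P]_(w in A) (Phi (w : PastT t, xi t w))%:E =
     \int[P]_(w in A) (M t w)%:E)%E.
  (* The constant collects the bounds for [M t], [G t], [sigma], the mean absolute gap and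
     [absPsi t], in this order. *)
  apply: (@independent_integral_on _ _ _ _ _ _ _ _ (to_past t) (xi t) _ A
    (@Phi t) (M t) (n%:R + n%:R + `|sigma| + gapC + n%:R)) => //.
  - move=> B C pB mC; exact: past_independent xi_iid.2 t0 pB mC.
  - exact: measurable_Phi.
  - by rewrite !addr_ge0// fine_ge0// integral_ge0.
  - move=> w Aw; rewrite integral_distribution_xi//.
    apply: (le_trans (integral_abs_Phi_le w t0)); rewrite lee_fin.
    have [hM _ hP hG] := bound _ Aw.
    have := ler_normB (M t w + G t w) sigma; have := ler_normD (M t w) (G t w).
    lra.
  - by move=> w Aw; rewrite integral_distribution_xi// integral_Phi.
have mM : measurable_fun setT (M t) by apply: pastT_Omega; exact: measurable_M.
have mM1 : measurable_fun setT (M t.+1).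
  by apply: pastT_Omega; exact: measurable_M.
(* Obtained from [M_succ] by dropping the nonnegative term in [V t.+1], the only one not bounded on
   [A]. *)
have le0 w : A w -> - n%:R - eta^-1 * n%:R - n%:R - sigma <= M t.+1 w.
  move=> Aw; rewrite M_succ//; have [hM hV _ hG] := bound _ Aw.
  have V1 : 0 <= eta^-1 * V t.+1 w.
    by apply: mulr_ge0; [rewrite invr_ge0 ltW|exact: V_ge0].
  have V2 : eta^-1 * V t w <= eta^-1 * n%:R by rewrite ler_pM2l ?invr_gt0.
  by move: hM hG; rewrite !ler_norml mulrBr; lra.
have le1 : {ae P, forall w, A w -> M t.+1 w <= Phi (w : PastT t, xi t w)}.
  have := one_step t0.
  apply: (@filterS _ _ (ae_filter_ringOfSetsType P)) => w step _.
  by rewrite M_succ// /Phi /= mulrBr; lra.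
have [iM1 leM1] := ae_le_integral mA (measurable_funTS mM1) iPhi le0 le1.
split => //; last by rewrite -PhiM.
apply: (@le_integrable _ _ _ _ _ _ _ (cst n%:R%:E)) => //.
- exact/measurable_EFinP/measurable_funTS.
- move=> w Aw /=; rewrite lee_fin; apply: le_trans (ler_norm _).
  by have [] := bound _ Aw.
- exact: finite_measure_integrable_cst.
Qed.

Let M_one w : M 1%N w = eta^-1 * bregman psi xs x1.
Proof. by rewrite /M big_geq// addr0 mul0r subr0 /V (smd_init x_smd). Qed.

Lemma potential_funeneg_le t : (0 < t)%N ->
  (\int[P]_w (EFin \o M t)^\- w <= \int[P]_w (EFin \o M t.+1)^\- w)%E.
Proof.
move=> t0.
apply: (@local_step_funeneg_le _ _ _ _ _ P (to_past t) (M t) (tau t)).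
- exact: measurable_M.
- exact: measurable_tau.
- by apply: pastT_Omega; exact: measurable_M.
- by move=> n A mA; exact: local_step.
Qed.

(** By induction: finiteness of the negative part descends one step to feed the induction
    hypothesis, then integrability and the bound climb back up. *)
Lemma potential_integral_le t :
  (\int[P]_w (EFin \o M t.+1)^\- w < +oo)%E ->
  P.-integrable setT (EFin \o M t.+1) /\
  (\int[P]_w (M t.+1 w)%:E <= (eta^-1 * bregman psi xs x1)%:E)%E.
Proof.
elim: t => [_|t IH Mneg].
  split.
    rewrite (_ : EFin \o M 1 = cst (eta^-1 * bregman psi xs x1)%:E).
      exact: finite_measure_integrable_cst.
    by apply/funext => w; rewrite /= M_one.
  under eq_integral do rewrite M_one.
  by rewrite integral_cst// [X in (_ * X)%E]probability_setT mule1.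
have [iM leM] := IH (le_lt_trans (potential_funeneg_le (ltn0Sn t)) Mneg).
have [iM1 leM1] : P.-integrable setT (EFin \o M t.+2) /\
    (\int[P]_w (M t.+2 w)%:E <= \int[P]_w (M t.+1 w)%:E)%E.
  apply: (@local_step_integral_le _ _ _ _ _ P (to_past t.+1) (M t.+1)
    (tau t.+1)) => //.
  - exact: measurable_M.
  - exact: measurable_tau.
  - by apply: pastT_Omega; exact: measurable_M.
  - by move=> n A mA; exact: local_step.
by split => //; exact: le_trans leM.
Qed.

Lemma mean_bregman_le t : (0 < t)%N ->
  has_expectation P (fun w => t%:R^-1 *
    \sum_(1 <= s < t.+1) bregman (mean_objective mu F) xs (x s w)) ->
  ('E_P[fun w => (t%:R^-1 *
      \sum_(1 <= s < t.+1) bregman (mean_objective mu F) xs (x s w))%R]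
    <= (bregman psi xs x1 / (eta * t%:R))%:E + sigma2 mu F X xs)%E.
Proof.
move=> t0; set Z := fun w => _; move=> [mZ Zfin].
have t0R : 0 < t%:R :> R by rewrite ltr0n.
have mEZ : measurable_fun setT (EFin \o Z) by exact/measurable_EFinP.
have sigma_ge0 : 0 <= sigma by exact: fine_ge0 (sigma2_ge0 obj Xxs sigma_fin).
have mM : measurable_fun setT (EFin \o M t.+1).
  by apply/measurable_EFinP; apply: pastT_Omega; exact: measurable_M.
(* The potential at time [t.+1] has accumulated exactly the [t] divergences averaged by [Z]. *)
have MZ w : M t.+1 w = eta^-1 * V t.+1 w + t%:R * (Z w - sigma).
  by rewrite /M /Z /= (mulrBr t%:R) mulVKf ?gt_eqF// addrA.
have V0 w : 0 <= eta^-1 * V t.+1 w.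
  by apply: mulr_ge0; [rewrite invr_ge0 ltW|exact: V_ge0].
rewrite unlock.
(* If the negative part has infinite integral, the positive part has a finite one and the
   expectation is -oo. *)
have [Zneg|] := ltP (\int[P]_w (EFin \o Z)^\- w)%E +oo%E; last first.
  rewrite leye_eq => /eqP Zneg; case: Zfin => [Zpos|]; last by rewrite Zneg.
  rewrite integralE Zneg.
  have /fineK <- : (\int[P]_w (EFin \o Z)^\+ w)%E \is a fin_num.
    by rewrite ge0_fin_numE// integral_ge0.
  by rewrite /= leNye.
(* As [V] and [sigma] are nonnegative, the negative part of [M t.+1] is at most [t] times that of
   [Z], plus [t * sigma]. *)
have Mneg : (\int[P]_w (EFin \o M t.+1)^\- w < +oo)%E.
  apply: (@le_lt_trans _ _
    (\int[P]_w (t%:R%:E * (EFin \o Z)^\- w + (t%:R * sigma)%:E))%E).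
    apply: ge0_le_integral => //.
    - exact: measurable_funeneg.
    - apply: emeasurable_funD => //; apply: measurable_funeM.
      exact: measurable_funeneg.
    - move=> w _; rewrite !funenegE /= -!EFin_max -EFinM -EFinD lee_fin.
      rewrite maxr_pMr ?(ltW t0R)// mulr0 MZ ge_max; apply/andP; split.
        have : t%:R * - Z w <= Num.max (t%:R * - Z w) 0 by rewrite le_max lexx.
        by have := V0 w; rewrite mulrBr; lra.
      by rewrite addr_ge0// ?mulr_ge0 ?(ltW t0R)// le_max lexx orbT.
  rewrite ge0_integralD//; last 3 first.
  - by move=> w _; rewrite mule_ge0// lee_fin ltW.
  - by apply: measurable_funeM; exact: measurable_funeneg.
  - by move=> w _; rewrite lee_fin mulr_ge0// ltW.
  rewrite ge0_integralZl//; last exact: measurable_funeneg.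
  apply: lte_add_pinfty.
    by apply: lte_mul_pinfty; rewrite ?lee_fin ?(ltW t0R).
  by rewrite integral_cst// [X in (_ * X)%E]probability_setT mule1 ltry.
have [iM leM] := potential_integral_le Mneg.
(* [H] exceeds [Z] by the nonnegative term [V t.+1 w / (eta * t)], and its mean is controlled by the
   potential bound. *)
pose H w := t%:R^-1 * M t.+1 w + sigma.
have ZH w : Z w <= H w.
  rewrite /H MZ mulrDr mulKf ?gt_eqF//.
  by have : 0 <= t%:R^-1 * (eta^-1 * V t.+1 w);
    [rewrite mulr_ge0// invr_ge0 ltW|lra].
have iH : P.-integrable setT (EFin \o H).
  rewrite /H (_ : _ \o _ =
    (fun w => t%:R^-1%:E * (EFin \o M t.+1) w + (cst sigma%:E) w)%E)//.
  apply: integrableD => //; first exact: integrableZl.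
  exact: finite_measure_integrable_cst.
have Hint : (\int[P]_w (H w)%:E <=
    (bregman psi xs x1 / (eta * t%:R))%:E + sigma%:E)%E.
  under eq_integral do rewrite EFinD EFinM.
  rewrite integralD//; last 2 first.
  - exact: integrableZl.
  - exact: finite_measure_integrable_cst.
  rewrite integral_cst// [X in (_ * X)%E]probability_setT mule1 leeD2rE//.
  rewrite integralZl//.
  have -> : bregman psi xs x1 / (eta * t%:R) =
      t%:R^-1 * (eta^-1 * bregman psi xs x1) by rewrite invfM; ring.
  by rewrite EFinM lee_pmul2l// lte_fin invr_gt0.
have iZ : P.-integrable setT (EFin \o Z).
  apply: integrable_posneg => //.
  have Hp : (\int[P]_w (EFin \o H)^\+ w < +oo)%E.
    exact: integral_funepos_lt_pinfty.
  apply: le_lt_trans Hp; apply: ge0_le_integral => //.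
  - exact: measurable_funepos.
  - by apply: measurable_funepos; exact: measurable_int iH.
  - move=> w _; rewrite !funeposE ge_max !le_max lee_fin ZH/=.
    by rewrite lexx orbT.
rewrite -(fineK (sigma2_fin_num obj Xxs sigma_fin)).
by apply: le_trans Hint; apply: le_integral => // w _; rewrite lee_fin.
Qed.

End stochastic_mirror_descent.

Theorem theorem3 (R : realType) (d : nat)
  (X D : set 'rV[R]_d) (psi : 'rV[R]_d -> R)
  (dXi : measure_display) (Xi : measurableType dXi) (mu : probability Xi R)
  (F : Xi -> 'rV[R]_d -> R)
  (dO : measure_display) (Omega : measurableType dO) (P : probability Omega R)
  (xi : nat -> {RV P >-> Xi})
  (L eta : R) (x1 : 'rV[R]_d) (x : nat -> Omega -> 'rV[R]_d)
  (X_nonempty : X !=set0) (X_closed : closed X) (X_convex : convex_set X)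
  (X_sub_D : X `<=` D) (D_convex : convex_set D)
  (psi_convex : convex_function D psi)
  (psi_diff : forall y, D° y -> differentiable psi y)
  (psi_interior : interior_condition psi X D)
  (F_objective : stochastic_objective mu F X D)
  (minimizers_nonempty : argmin X (mean_objective mu F) !=set0)
  (sigma2_finite : forall xstar, argmin X (mean_objective mu F) xstar ->
     (sigma2 mu F X xstar < +oo)%E)
  (L_gt0 : 0 < L)
  (F_smooth : {ae mu, forall z, rel_smooth psi X D L (F z)})
  (eta_gt0 : 0 < eta) (eta_le : eta <= 1 / L)
  (xi_iid : iid_copies mu xi)
  (x1_X : X x1) (x1_D : D° x1)
  (x_smd : smd_iterates psi X F eta xi x1 x) :
  forall (xstar : 'rV[R]_d) (t : nat),
    argmin X (mean_objective mu F) xstar -> (1 <= t)%N ->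
    has_expectation P (fun w => t%:R^-1 *
      \sum_(1 <= s < t.+1) bregman (mean_objective mu F) xstar (x s w)) ->
    ('E_P[fun w => (t%:R^-1 *
        \sum_(1 <= s < t.+1) bregman (mean_objective mu F) xstar (x s w))%R]
      <= (bregman psi xstar x1 / (eta * t%:R))%:E + sigma2 mu F X xstar)%E.
Proof.
move=> xstar t [Xxs xs_min] t0 expZ.
exact: (mean_bregman_le X_convex X_sub_D psi_convex psi_diff psi_interior
  F_objective L_gt0 F_smooth eta_gt0 eta_le xi_iid x1_X x1_D x_smd Xxs
  (sigma2_finite _ (conj Xxs xs_min)) t0 expZ).
Qed.
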